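(* Let $d \ge 2$ be an integer and let $u \in \mathbb{R}^d$ be a Euclidean unit vector. Let $X_1, \dots, X_{2d} \subset \mathbb{R}^d$ be sets and let $c_1, \dots, c_{2d} \in \mathbb{R}^d$ be points such that $$c_i + [-u, u] \subset \operatorname{conv} X_i \qquad \text{for every } i \in \{1,\dots,2d\}.$$ Then there are points $x_i \in X_i$, $i \in \{1,\dots,2d\}$, and a point $c \in \operatorname{conv}\{c_1, \dots, c_{2d}\}$ such that $$c + [-u, u] \subset \operatorname{conv}\{x_1, \dots, x_{2d}\}.$$
   Context: $[-u,u] := \{\lambda u : |\lambda| \le 1\}$, and $\operatorname{conv} X$ is the convex hull of $X$. The sets $X_i$ are arbitrary (they may be infinite and may overlap); exactly one point is chosen from each $X_i$, and chosen points with different indices may coincide. *)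

(* Defs.v *)
From mathcomp Require Import all_boot all_order all_algebra.
From mathcomp Require Import boolp classical_sets reals convex.

Set Implicit Arguments.
Unset Strict Implicit.
Unset Printing Implicit Defensive.

Import Order.TTheory GRing.Theory Num.Theory.

Local Open Scope classical_set_scope.
Local Open Scope ring_scope.

(* The library norm `|v| on 'rV[R]_d is the sup norm, hence this definition. *)
Definition euclidean_norm (R : realType) (d : nat) (v : 'rV[R]_d) : R :=
  Num.sqrt (\sum_(i < d) v ord0 i ^+ 2).

Definition convex_hull (R : realType) (d : nat) (X : set 'rV[R]_d) :
    set 'rV[R]_d :=
  smallest (@convex_set R 'rV[R]_d) X.

Definition sym_segment (R : realType) (d : nat) (u : 'rV[R]_d) :
    set 'rV[R]_d :=
  [set l *: u | l in [set l : R | `|l| <= 1]].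

Definition translate (R : realType) (d : nat) (c : 'rV[R]_d)
    (A : set 'rV[R]_d) : set 'rV[R]_d :=
  [set c + v | v in A].

(* Main.v *)
Require Import Defs.
From mathcomp Require Import all_boot all_order all_algebra.
From mathcomp Require Import boolp classical_sets reals convex.
From mathcomp Require Import interval_inference topology normedtype derive.
From mathcomp Require Import ring lra.

(** Penalize the defect of a rainbow choice [x].  For [z] in [conv c] consider the
    cones with apices [z + u] and [z - u] spanned by the points [x i]; they have to
    contain [z + 2 u] and [z - 2 u] respectively, which puts
    [z + s u] and [z - s' u] in [conv x] for some [s, s' >= 1].  The energy is
    the sum of the two squared distances, minimized over [x], [z] and the cone
    coefficients [a], [b].  At a minimum, with residuals [v] and [w]:
    - moving [z] towards [c i] gives
      [A <v, c i - z> + B <w, c i - z> <= 0], where [A], [B] are the sums of [a], [b];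
    - if colour [i] is unused by [a] and [b], replacing [x i] by a point of [X i]
      below [c i + u] in direction [v] (or below [c i - u] in direction [w]) would
      lower the energy unless [v = w = 0].
    By the conic Caratheodory theorem [a] and [b] need at most [d] colours each,
    and only [d - 1] as long as the residual is non-zero; so, with [2 d] colours,
    either both residuals vanish or some colour is unused.
    The cone coefficients are unbounded and [A], [B] may vanish, so a perturbed
    energy is minimized instead: [a] and [b] are sub-probability weights, the unit
    target is replaced by [eps] times the slack, and a small multiple [eta] of a
    fixed point [e] of [conv c] is added.  A side with [A = 1] may then keep a
    non-zero residual, but only of order [eps], and compactness together with the
    finiteness of the set of rainbow choices removes the perturbation. *)

Set Implicit Arguments.
Unset Strict Implicit.
Unset Printing Implicit Defensive.

Import Order.TTheory GRing.Theory Num.Theory.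
Import numFieldNormedType.Exports.

Local Open Scope classical_set_scope.
Local Open Scope ring_scope.

(** * Euclidean inner product *)

Definition inner (R : realType) (d : nat) (v w : 'rV[R]_d) : R :=
  \sum_j v ord0 j * w ord0 j.

Section Inner.
Context {R : realType} {d : nat}.
Implicit Types v w : 'rV[R]_d.

Lemma innerC v w : inner v w = inner w v.
Proof. by apply: eq_bigr => j _; rewrite mulrC. Qed.

Lemma innerDr v w1 w2 : inner v (w1 + w2) = inner v w1 + inner v w2.
Proof. by rewrite -big_split; apply: eq_bigr => j _; rewrite mxE mulrDr. Qed.

Lemma innerZr v k w : inner v (k *: w) = k * inner v w.
Proof. by rewrite mulr_sumr; apply: eq_bigr => j _; rewrite mxE mulrCA. Qed.

Lemma innerNr v w : inner v (- w) = - inner v w.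
Proof. by rewrite -scaleN1r innerZr mulN1r. Qed.

Lemma inner0r v : inner v 0 = 0.
Proof. by rewrite -(scale0r 0) innerZr mul0r. Qed.

Lemma innerDl v1 v2 w : inner (v1 + v2) w = inner v1 w + inner v2 w.
Proof. by rewrite innerC innerDr !(innerC w). Qed.

Lemma innerZl k v w : inner (k *: v) w = k * inner v w.
Proof. by rewrite innerC innerZr innerC. Qed.

Lemma innerNl v w : inner (- v) w = - inner v w.
Proof. by rewrite innerC innerNr innerC. Qed.

Definition innerE := (innerDl, innerDr, innerZl, innerZr, innerNl, innerNr).

Lemma inner_ge0 v : 0 <= inner v v.
Proof. by apply: sumr_ge0 => j _; rewrite -expr2 sqr_ge0. Qed.

Lemma inner_eq0 v : inner v v = 0 -> v = 0.
Proof.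
move=> /eqP; rewrite psumr_eq0 => [/allP v0|j _]; last by rewrite -expr2 sqr_ge0.
apply/rowP => j; rewrite mxE; have /implyP/(_ isT) := v0 j (mem_index_enum j).
by rewrite mulf_eq0 orbb => /eqP.
Qed.

Lemma inner_addl_le v w :
  inner (v + w) (v + w) <= 2 * inner v v + 2 * inner w w.
Proof.
have := inner_ge0 (v - w); rewrite !innerE (innerC w v); lra.
Qed.

End Inner.

(** * Weights, barycentres and convex hulls *)

Definition prob (R : realType) (n : nat) (g : 'I_n -> R) :=
  (forall i, 0 <= g i) /\ \sum_i g i = 1.

Definition subprob (R : realType) (n : nat) (a : 'I_n -> R) :=
  (forall i, 0 <= a i) /\ \sum_i a i <= 1.

Definition bary (R : realType) (d n : nat) (g : 'I_n -> R)
    (c : 'I_n -> 'rV[R]_d) : 'rV[R]_d :=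
  \sum_i g i *: c i.

Section ConvexHull.
Context {R : realType} {d : nat}.
Implicit Types X : set 'rV[R]_d.

Lemma convex_hull_seg X p q (k : R) : 0 <= k <= 1 ->
  convex_hull X p -> convex_hull X q ->
  convex_hull X (k *: p + (1 - k) *: q).
Proof.
move=> k01 Xp Xq A [cA XA].
have -> : k *: p + (1 - k) *: q =
    conv (Itv01 (proj1 (andP k01)) (proj2 (andP k01)))
         (p : convex_lmodType 'rV[R]_d) q by [].
apply/set_mem/cA; apply/mem_set; [exact: Xp|exact: Xq].
Qed.

Lemma bary_hull (n : nat) (g : 'I_n -> R) (x : 'I_n -> 'rV[R]_d) :
  prob g -> convex_hull (range x) (bary g x).
Proof.
move=> [g0 g1].
(* Partial sums are normalized by their total weight, so that each induction step is a convex
   combination of two hull points. *)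
have H (s : seq 'I_n) : 0 < \sum_(i <- s) g i ->
    convex_hull (range x)
      ((\sum_(i <- s) g i)^-1 *: \sum_(i <- s) g i *: x i).
  elim: s => [|i s IH]; first by rewrite big_nil ltxx.
  rewrite !big_cons; set G := \sum_(j <- s) g j in IH *; set Y := \sum_(j <- s) _.
  have G0 : 0 <= G by apply: sumr_ge0.
  have Xi : convex_hull (range x) (x i).
    by apply: sub_gen_smallest; exists i.
  move=> p0; have [Gp|] := ltP 0 G; last first.
    move=> Gle; have GE : G = 0 by apply/le_anti/andP.
    have YE : Y = 0.
      rewrite /Y big_seq big1 // => j js; suff -> : g j = 0 by rewrite scale0r.
      apply/eqP; rewrite eq_le g0 andbT -GE /G (big_rem j js) /= lerDl.
      exact: sumr_ge0.
    move: p0; rewrite YE GE !addr0 => p0.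
    by rewrite scalerA mulVf ?scale1r // gt_eqF.
  have -> : (g i + G)^-1 *: (g i *: x i + Y) =
      (g i / (g i + G)) *: x i + (1 - g i / (g i + G)) *: (G^-1 *: Y).
    rewrite scalerDr !scalerA mulrC; congr (_ + _ *: _); field.
    by rewrite !gt_eqF.
  apply: convex_hull_seg => //; last exact: IH.
  by rewrite divr_ge0 ?(ltW p0) //= ler_pdivrMr // mul1r lerDl.
by have := H (index_enum _); rewrite g1 invr1 scale1r ltr01; apply.
Qed.

(* The set of points with this property is convex and contains [X]; it replaces
   the representation of a hull point as a finite convex combination. *)
Lemma convex_hull_finite X z : convex_hull X z ->
  exists s : seq 'rV[R]_d, (forall y, y \in s -> X y) /\
    forall v, exists2 y, y \in s & inner v y <= inner v z.
Proof.
move=> Xz; apply: (Xz [set z | _]) => {z Xz}; split=> [p q k|z Xz]; last first.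
  exists [:: z]; split=> [y|v]; first by rewrite inE => /eqP ->.
  by exists z; rewrite ?inE.
move=> /set_mem[s [sX sp]] /set_mem[t [tX tq]]; apply/mem_set.
exists (s ++ t); split=> [y|v].
  by rewrite mem_cat => /orP[/sX|/tX].
have [yp yps ypv] := sp v; have [yq yqt yqv] := tq v.
change (exists2 y, y \in s ++ t & inner v y <=
  inner v (k%:num *: (p : 'rV[R]_d) + (1 - k%:num) *: (q : 'rV[R]_d))).
have k0 : 0 <= k%:num by [].
have k1 : 0 <= 1 - k%:num by rewrite subr_ge0.
rewrite !innerE; have [pq|qp] := leP (inner v p) (inner v q).
  exists yp; first by rewrite mem_cat yps.
  by have := ler_wpM2l k1 pq; nra.
exists yq; first by rewrite mem_cat yqt orbT.
by have := ler_wpM2l k0 (ltW qp); nra.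
Qed.

End ConvexHull.

(** * First-order condition and conic Caratheodory theorem *)

Lemma first_order_ge0 (R : realFieldType) (p q : R) :
  (forall t, 0 < t -> t <= 1 -> 0 <= t * p + t ^+ 2 * q) -> 0 <= p.
Proof.
move=> H; rewrite leNgt; apply/negP => p0.
have q1 : 0 < 1 + `|q| by rewrite ltr_wpDr.
have k0 : 0 < 1 - p + `|q| by have := normr_ge0 q; lra.
(* Chosen so that [p + t * |q| = - t * (1 - p)], which is negative when [p < 0]. *)
pose t := - p / (1 - p + `|q|).
have tp : 0 < t by rewrite divr_gt0 // oppr_gt0.
have t1 : t <= 1 by rewrite ler_pdivrMr // mul1r; have := normr_ge0 q; lra.
have := H t tp t1; rewrite expr2 -mulrA -mulrDr pmulr_rge0 // => h.
have tk : t * (1 - p + `|q|) = - p by rewrite /t mulfVK // gt_eqF.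
have : t * q <= t * `|q| by rewrite ler_pM2l // ler_norm.
by nra.
Qed.

Section Caratheodory.
Context {R : realType} {d n : nat}.
Implicit Types (V : 'I_n -> 'rV[R]_d) (a k : 'I_n -> R).

(** Linear independence of the [V i] with [a i] non-zero, expressed by coefficients on all indices
    that vanish off the support. *)
Definition indep_supp V a := forall k,
  (forall i, a i = 0 -> k i = 0) -> \sum_i k i *: V i = 0 -> forall i, k i = 0.

(** Moving along a linear dependence until a coefficient vanishes shrinks the support. The bound on
    the sums keeps sub-probability weights sub-probability. *)
Lemma conic_caratheodory V a : (forall i, 0 <= a i) ->
  exists a', [/\ forall i, 0 <= a' i, \sum_i a' i <= \sum_i a i,
    \sum_i a' i *: V i = \sum_i a i *: V i & indep_supp V a'].
Proof.
have [m] := ubnP #|[pred i | a i != 0]|; elim: m => // m IH in a * => am a0.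
have [ia|nia] := pselect (indep_supp V a); first by exists a.
have [k [ka kV [i0 ki0]]] : exists k, [/\ forall i, a i = 0 -> k i = 0,
    \sum_i k i *: V i = 0 & exists i, k i != 0].
  apply: contrapT => nk; apply: nia => k ka kV i; apply: contrapT => /eqP ki.
  by apply: nk; exists k; split => //; exists i.
(* The sign of the dependence is chosen so that the total weight does not grow. *)
wlog ks : k ka kV ki0 / \sum_i k i <= 0.
  move=> W; have [|ks] := leP (\sum_i k i) 0; first exact: W.
  apply: (W (fun i => - k i)); rewrite ?oppr_eq0 //.
  - by move=> i /ka ->; rewrite oppr0.
  - by under eq_bigr do rewrite scaleNr; rewrite sumrN kV oppr0.
  - by rewrite sumrN oppr_le0 ltW.
have [i1 ki1] : exists i, k i < 0.
  apply: contrapT => nk; have k0 i : 0 <= k i.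
    by rewrite leNgt; apply/negP => ki; apply: nk; exists i.
  have /eqP : \sum_i k i = 0 by apply/le_anti; rewrite ks sumr_ge0.
  rewrite psumr_eq0 // => /allP/(_ i0 (mem_index_enum i0)).
  by rewrite (negbTE ki0).
(* Ratio test: [j] is the coefficient that reaches 0 first. *)
have [j kj jmin] := @arg_minP _ _ _ i1 (fun i => k i < 0) (fun i => a i / - k i) ki1.
set t := a j / - k j in jmin.
have t0 : 0 <= t by rewrite divr_ge0 // oppr_ge0 ltW.
pose a1 i := a i + t * k i.
have a1j : a1 j = 0.
  by rewrite /a1 /t; field; rewrite lt_eqF.
have a10 i : 0 <= a1 i.
  have [ki|ki] := leP 0 (k i).
    by apply: addr_ge0; [exact: a0|exact: mulr_ge0].
  have := jmin i ki; rewrite ler_pdivlMr ?oppr_gt0 // /a1; lra.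
have sub : [pred i | a1 i != 0] \proper [pred i | a i != 0].
  apply/fintype.properP; split.
    apply/fintype.subsetP => i; rewrite !inE; apply: contra => /eqP ai.
    by rewrite /a1 ai ka // mulr0 addr0.
  exists j; rewrite !inE ?a1j ?eqxx //.
  by apply/negP => /eqP /ka kj0; rewrite kj0 ltxx in kj.
have [|//|a' [a'0 a's a'V a'i]] := IH a1.
  exact: leq_trans (proper_card sub) _.
exists a'; split => //.
  apply: le_trans a's _; rewrite /a1 big_split /= -mulr_sumr gerDl.
  by rewrite mulr_ge0_le0.
rewrite a'V /a1; under eq_bigr do rewrite scalerDl -scalerA.
by rewrite big_split /= -scaler_sumr kV scaler0 addr0.
Qed.

Lemma indep_supp_row_free V a : indep_supp V a ->
  row_free (\matrix_(k < #|[pred i | a i != 0]|) V (enum_val k)).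
Proof.
set S := [pred i | a i != 0] => ia; apply: inj_row_free => v vV.
have Hk (k0 : 'I_#|S|) :
    \sum_k (if enum_val k == enum_val k0 then v ord0 k else 0) = v ord0 k0.
  rewrite (bigD1 k0) //= eqxx big1 ?addr0 // => k kk0.
  by rewrite (inj_eq enum_val_inj) (negbTE kk0).
apply/rowP => k0; rewrite mxE -Hk.
(* The row [v] is extended by zero from the support to all indices. *)
apply: (ia (fun i => \sum_k (if enum_val k == i then v ord0 k else 0))).
  move=> i ai; rewrite big1 // => k _; case: eqP => // ki.
  by have := enum_valP k; rewrite ki inE ai eqxx.
rewrite -[RHS]vV mulmx_sum_row; under eq_bigr do rewrite scaler_suml.
rewrite exchange_big; apply: eq_bigr => k _; rewrite (bigD1 (enum_val k)) //=.
rewrite eqxx rowK big1 ?addr0 // => i; rewrite eq_sym => /negbTE ->.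
by rewrite scale0r.
Qed.

Lemma indep_supp_card V a : indep_supp V a -> (#|[pred i | a i != 0%R]| <= d)%N.
Proof. by move=> /indep_supp_row_free/eqP <-; exact: rank_leq_col. Qed.

(** Independent vectors, at least [d] in number, form a basis, and only 0 is orthogonal to a
    basis. *)
Lemma indep_supp_span V a v : indep_supp V a -> (d <= #|[pred i | a i != 0%R]|)%N ->
  (forall i, a i != 0 -> inner v (V i) = 0) -> v = 0.
Proof.
move=> ia; have cd := indep_supp_card ia; move/indep_supp_row_free: ia.
set W := \matrix_k _ => fW dS vV.
have : row_free W^T.
  by rewrite /row_free mxrank_tr; move: fW => /eqP ->; rewrite eqn_leq cd.
move=> /row_freeP[B WB]; rewrite -[v]mulmx1 -WB mulmxA.
suff -> : v *m W^T = 0 by rewrite mul0mx.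
apply/rowP => k; rewrite !mxE.
have := vV (enum_val k) (enum_valP k); apply: etrans.
by apply: eq_bigr => j _; rewrite !mxE.
Qed.

End Caratheodory.

(** * Calculus of weights *)

Definition unit_wt (R : realType) (n : nat) (i : 'I_n) : 'I_n -> R :=
  fun k => (k == i)%:R.

Definition mix (R : realType) (n : nat) (t : R) (a b : 'I_n -> R) : 'I_n -> R :=
  fun i => (1 - t) * a i + t * b i.

Section Weights.
Context {R : realType} {d n : nat}.
Implicit Types (a b g : 'I_n -> R) (x : 'I_n -> 'rV[R]_d).

Lemma sum_unit_wt (i : 'I_n) : \sum_k unit_wt R i k = 1.
Proof.
rewrite (bigD1 i) //= /unit_wt eqxx big1 ?addr0 // => k /negbTE ->.
by [].
Qed.

Lemma bary_unit_wt (i : 'I_n) x : bary (unit_wt R i) x = x i.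
Proof.
rewrite /bary (bigD1 i) //= /unit_wt eqxx big1 ?addr0 ?scale1r // => k.
by move=> /negbTE ->; rewrite scale0r.
Qed.

Lemma bary_bump a x i t :
  bary (fun k => a k + t * unit_wt R i k) x = bary a x + t *: x i.
Proof.
rewrite -[in RHS]bary_unit_wt /bary scaler_sumr -big_split.
by apply: eq_bigr => k _; rewrite scalerDl scalerA.
Qed.

Lemma prob_unit_wt (i : 'I_n) : prob (unit_wt R i).
Proof. by split=> [k|]; [rewrite /unit_wt ler0n | exact: sum_unit_wt]. Qed.

Lemma prob_subprob g : prob g -> subprob g.
Proof. by move=> [g0 g1]; split=> //; rewrite g1. Qed.

Lemma sum_mix t a b :
  \sum_i mix t a b i = (1 - t) * \sum_i a i + t * \sum_i b i.
Proof. by rewrite big_split /= -!mulr_sumr. Qed.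

Lemma bary_mix t a b x : bary (mix t a b) x = (1 - t) *: bary a x + t *: bary b x.
Proof.
rewrite /bary !scaler_sumr -big_split; apply: eq_bigr => i _ /=.
by rewrite !scalerA -scalerDl.
Qed.

Lemma mix_ge0 t a b : 0 <= t <= 1 -> (forall i, 0 <= a i) ->
  (forall i, 0 <= b i) -> forall i, 0 <= mix t a b i.
Proof.
move=> /andP[t0 t1] a0 b0 i.
by apply: addr_ge0; apply: mulr_ge0; rewrite ?subr_ge0.
Qed.

Lemma prob_mix t a b : 0 <= t <= 1 -> prob a -> prob b -> prob (mix t a b).
Proof.
move=> t01 [a0 a1] [b0 b1]; split=> [i|].
  exact: (mix_ge0 t01 a0 b0).
by rewrite sum_mix a1 b1; ring.
Qed.

Lemma subprob_mix t a b : 0 <= t <= 1 ->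
  subprob a -> subprob b -> subprob (mix t a b).
Proof.
move=> t01 [a0 a1] [b0 b1]; split=> [i|].
  exact: (mix_ge0 t01 a0 b0).
move/andP: t01 => [t0 t1]; rewrite sum_mix.
have t1' : 0 <= 1 - t by rewrite subr_ge0.
by have := ler_wpM2l t0 b1; have := ler_wpM2l t1' a1; lra.
Qed.

Lemma bary_sub_cst a x z :
  \sum_i a i *: (x i - z) = bary a x - (\sum_i a i) *: z.
Proof.
rewrite /bary scaler_suml -sumrB; apply: eq_bigr => i _.
by rewrite scalerBr.
Qed.

Lemma inner_bary v g x : inner v (bary g x) = \sum_i g i * inner v (x i).
Proof.
rewrite /bary (big_morph (inner v) (innerDr v) (inner0r v)).
by apply: eq_bigr => i _; exact: innerZr.
Qed.

(* Jensen's inequality for the squared distance to [e]. *)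
Lemma bary_dist_le g x e : prob g ->
  inner (e - bary g x) (e - bary g x) <= \sum_i inner (e - x i) (e - x i).
Proof.
move=> [g0 g1]; set m := e - bary g x.
have mE : m = \sum_i g i *: (e - x i).
  rewrite -[LHS]opprK opprB -[e in LHS]scale1r -g1 -bary_sub_cst -sumrN.
  by apply: eq_bigr => i _; rewrite -scalerN opprB.
have : 0 <= \sum_i g i * inner (e - x i - m) (e - x i - m).
  by apply: sumr_ge0 => i _; rewrite mulr_ge0 ?inner_ge0.
have -> : \sum_i g i * inner (e - x i - m) (e - x i - m) =
    \sum_i g i * inner (e - x i) (e - x i) - inner m m.
  have mm : inner m m = \sum_i g i * inner m (e - x i).
    by rewrite -inner_bary /bary -mE.
  have mm' : inner m m = \sum_i g i * inner m m by rewrite -mulr_suml g1 mul1r.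
  transitivity (\sum_i (g i * inner (e - x i) (e - x i) -
      (g i * inner m (e - x i) + g i * inner m (e - x i) - g i * inner m m))).
    apply: eq_bigr => i _; move: (e - x i) => w; clearbody m.
    by rewrite !innerE (innerC w m); ring.
  by rewrite sumrB sumrB big_split /= -mm -mm'; ring.
(* Each weight is at most 1; dropping it makes the bound independent of [g]. *)
rewrite subr_ge0 => /le_trans; apply; apply: ler_sum => i _.
rewrite -[leRHS]mul1r ler_wpM2r ?inner_ge0 // -g1 (bigD1 i) //= lerDl.
exact: sumr_ge0.
Qed.

End Weights.

(* With [A] the sum of [a] this is
   [\sum_i a i (x i - z - u) - eps (1 - A) u + eta (e - z)]; the other residual is
   obtained by changing [u] into [- u].  The term in [eta] makes the coefficient
   [- (A + eta)] of [z] negative even if [A = 0]. *)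
Definition resid (R : realType) (d n : nat) (eps eta : R) (e u z : 'rV[R]_d)
    (x : 'I_n -> 'rV[R]_d) (a : 'I_n -> R) : 'rV[R]_d :=
  \sum_i a i *: (x i - z - (1 - eps) *: u) + (eta *: (e - z) - eps *: u).

(** * Residuals and their optimality in the weights *)

Section Resid.
Context {R : realType} {d n : nat} (eps eta : R) (e u : 'rV[R]_d).
Implicit Types (a b : 'I_n -> R) (x : 'I_n -> 'rV[R]_d) (z : 'rV[R]_d).
Local Notation resid := (resid eps eta e u).

Lemma resid_mix z x t a b :
  resid z x (mix t a b) = resid z x a + t *: (resid z x b - resid z x a).
Proof.
rewrite /resid; set V := fun i => x i - z - (1 - eps) *: u.
rewrite -/(bary (mix t a b) V) -/(bary a V) -/(bary b V) bary_mix.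
move: (bary a V) (bary b V) => A B.
by apply/rowP => j; rewrite !mxE; ring.
Qed.

(** The total weight is 1 here, so there is no slack and [eps] drops out. *)
Lemma resid_unit_wt z x i :
  resid z x (unit_wt R i) = x i - z - u + eta *: (e - z).
Proof.
rewrite /resid -/(bary (unit_wt R i) (fun i => x i - z - (1 - eps) *: u)).
rewrite bary_unit_wt scalerBl scale1r; apply/rowP => j; rewrite !mxE; ring.
Qed.

Lemma resid_bump z x a i t :
  resid z x (fun k => a k + t * unit_wt R i k) =
  resid z x a + t *: (x i - z - (1 - eps) *: u).
Proof.
rewrite /resid addrAC; congr (_ + _).
exact: (bary_bump _ (fun i => x i - z - (1 - eps) *: u)).
Qed.

Lemma resid_shift z x a w :
  resid (z + w) x a = resid z x a - (\sum_i a i + eta) *: w.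
Proof.
rewrite /resid.
have -> : \sum_i a i *: (x i - (z + w) - (1 - eps) *: u) =
    \sum_i a i *: (x i - z - (1 - eps) *: u) - (\sum_i a i) *: w.
  rewrite scaler_suml -sumrB; apply: eq_bigr => i _.
  by apply/rowP => j; rewrite !mxE; ring.
by apply/rowP => j; rewrite !mxE; ring.
Qed.

(* The projection onto a convex set is characterized by an obtuse angle. *)
Lemma resid_obtuse z x a b : subprob a -> subprob b ->
  (forall a', subprob a' ->
    inner (resid z x a) (resid z x a) <= inner (resid z x a') (resid z x a')) ->
  inner (resid z x a) (resid z x a) <= inner (resid z x a) (resid z x b).
Proof.
move=> sa sb H; set v := resid z x a; set w := resid z x b.
suff : 0 <= 2 * inner v (w - v) by rewrite innerDr innerNr; lra.
apply: (@first_order_ge0 _ _ (inner (w - v) (w - v))) => t t0 t1.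
have := H (mix t a b); rewrite resid_mix -/v -/w.
move: (w - v) => h; clearbody v; rewrite !innerE (innerC h v) => H'.
have /H' : subprob (mix t a b) by apply: subprob_mix => //; rewrite (ltW t0).
by rewrite expr2; lra.
Qed.

(** A positive coefficient can be lowered, and slack in the total allows raising it; the derivative
    in both directions is non-negative, hence zero. *)
Lemma resid_orthogonal z x a i : subprob a -> \sum_k a k < 1 -> a i != 0 ->
  (forall a', subprob a' ->
    inner (resid z x a) (resid z x a) <= inner (resid z x a') (resid z x a')) ->
  inner (resid z x a) (x i - z - (1 - eps) *: u) = 0.
Proof.
move=> sa a1 ai H; have [a0 _] := sa.
have step t : 0 <= a i + t -> \sum_k a k + t <= 1 ->
    0 <= t * inner (resid z x a) (x i - z - (1 - eps) *: u).
  move=> t0 t1.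
  have sb : subprob (fun k => a k + t * unit_wt R i k).
    split=> [k|]; last by rewrite big_split /= -mulr_sumr sum_unit_wt mulr1.
    rewrite /unit_wt; case: eqP => [->|_]; first by rewrite mulr1.
    by rewrite mulr0 addr0.
  have := resid_obtuse sa sb H; rewrite resid_bump innerDr innerZr; lra.
have ai0 : 0 < a i by rewrite lt_def ai a0.
have := step (1 - \sum_k a k); have := step (- a i).
set p := inner _ _ => h1 h2.
have : 0 <= - a i * p by apply: h1; lra.
have : 0 <= (1 - \sum_k a k) * p by apply: h2; lra.
rewrite pmulr_rge0 ?subr_gt0 // mulNr oppr_ge0 pmulr_rle0 // => p1 p2.
by apply/le_anti/andP.
Qed.

End Resid.

Lemma bary_resid (R : realType) (d n : nat) (eps eta : R) (e u z : 'rV[R]_d)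
    (x : 'I_n -> 'rV[R]_d) (a : 'I_n -> R) :
  resid eps eta e u z x a = bary a x -
    (\sum_i a i) *: (z + (1 - eps) *: u) + (eta *: (e - z) - eps *: u).
Proof.
rewrite -bary_sub_cst /resid; congr (_ + _); apply: eq_bigr => i _.
by rewrite opprD addrA.
Qed.

(** * Removing the perturbation from a residual *)

Section Rescale.
Context {R : realType} {d n : nat} (eps eta : R) (e u z : 'rV[R]_d).
Variables (x : 'I_n -> 'rV[R]_d) (a : 'I_n -> R).
Let A := \sum_i a i.
(** The total coefficient of [- u] in the perturbed residual, since [A * (1 - eps) + eps = N].
    Division by it restores the unit target. *)
Let N := A + eps * (1 - A).
Hypothesis eps01 : 0 < eps <= 1.
Hypothesis sa : subprob a.

Let epsN : eps <= N.
Proof.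
have [a0 a1] := sa; have /andP[e0 e1] := eps01.
have A0 : 0 <= A by apply: sumr_ge0.
rewrite /N; nra.
Qed.

Let N0 : 0 < N. Proof. by apply: lt_le_trans epsN; case/andP: eps01. Qed.

Let rescaled : 'I_n -> R := fun i => N^-1 * a i.

Let sum_rescaled : \sum_i rescaled i = N^-1 * A.
Proof. by rewrite -mulr_sumr. Qed.

Let subprob_rescaled : subprob rescaled.
Proof.
have [a0 a1] := sa; have /andP[e0 e1] := eps01; split=> [i|].
  by apply: mulr_ge0 => //; rewrite invr_ge0 ltW.
rewrite sum_rescaled mulrC ler_pdivrMr // mul1r /N lerDl mulr_ge0 ?subr_ge0 //.
exact: ltW.
Qed.

Let resid_rescaled :
  N *: resid 1 0 e u z x rescaled = resid eps eta e u z x a - eta *: (e - z).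
Proof.
rewrite !bary_resid sum_rescaled.
have -> : bary rescaled x = N^-1 *: bary a x.
  by rewrite /bary scaler_sumr; apply: eq_bigr => i _; rewrite scalerA.
have NE : eps = N - A + A * eps by rewrite /N; ring.
have Nn : N != 0 by rewrite gt_eqF.
rewrite -/A; move: (bary a x) => B; apply/rowP => j; rewrite !mxE.
rewrite [in - (eps * _)]NE; move: A N Nn {NE} => A' N' Nn; field.
by [].
Qed.

Lemma resid_estimate (D : R) : eta = eps ^+ 2 ->
  inner (e - z) (e - z) <= D ->
  inner (resid eps eta e u z x a) (resid eps eta e u z x a) <= 2 * eps ^+ 2 ->
  resid eps eta e u z x a = 0 \/ A = 1 ->
  exists2 a', subprob a' &
    inner (resid 1 0 e u z x a') (resid 1 0 e u z x a') <= eps ^+ 2 * (4 + 2 * D).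
Proof.
move=> etaE eD; have /andP[e0 e1] := eps01.
have D0 : 0 <= D := le_trans (inner_ge0 _) eD.
set v := resid _ _ _ _ _ _ _ => vle v0A; exists rescaled => //.
set r := resid _ _ _ _ _ _ _.
have rE : N ^+ 2 * inner r r = inner (v - eta *: (e - z)) (v - eta *: (e - z)).
  by rewrite -resid_rescaled -/r innerZl innerZr mulrA expr2.
have r0 := inner_ge0 r.
have e2 : 0 < eps ^+ 2 by rewrite exprn_gt0.
have e21 : eps ^+ 2 <= 1 by rewrite exprn_ile1 // ltW.
have eta0 : 0 <= eta ^+ 2 by rewrite sqr_ge0.
have etaD : eta ^+ 2 * inner (e - z) (e - z) <= eps ^+ 2 * (eps ^+ 2 * D).
  by apply: le_trans (ler_wpM2l eta0 eD) _; rewrite etaE (expr2 (eps ^+ 2)) mulrA.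
(* If [v = 0], only the [eta] term is left; division by [N >= eps] turns [eta ^+ 2 = eps ^+ 4] into
   at most [eps ^+ 2]. If [A = 1], then [N = 1] and nothing is enlarged. *)
case: v0A => [v0|A1].
  move: rE; rewrite v0 sub0r innerNl innerNr opprK innerZl innerZr mulrA -expr2.
  move=> rE; have : eps ^+ 2 * inner r r <= eps ^+ 2 * (eps ^+ 2 * D).
    apply: le_trans etaD; rewrite -rE ler_wpM2r // lerXn2r // nnegrE ltW //.
  rewrite ler_pM2l // => /le_trans; apply; rewrite ler_pM2l //; lra.
have N1 : N = 1 by rewrite /N A1; ring.
move: rE; rewrite N1 expr1n mul1r => ->.
apply: le_trans (inner_addl_le _ _) _.
rewrite innerNl innerNr opprK innerZl innerZr [eta * (eta * _)]mulrA -expr2.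
have : eps ^+ 2 * (eps ^+ 2 * D) <= eps ^+ 2 * D.
  by rewrite ler_pM2l // ler_piMl.
lra.
Qed.

End Rescale.

(** * Continuity and compactness *)

Section Continuity.
Context {R : realType} {T : topologicalType}.
Implicit Types f g : T -> R.

Lemma continuous_add f g : continuous f -> continuous g ->
  continuous (fun p => f p + g p).
Proof. by move=> cf cg p; apply: cvgD; [exact: cf | exact: cg]. Qed.

Lemma continuous_mul f g : continuous f -> continuous g ->
  continuous (fun p => f p * g p).
Proof. by move=> cf cg p; apply: cvgM; [exact: cf | exact: cg]. Qed.

Lemma continuous_opp f : continuous f -> continuous (fun p => - f p).
Proof. by move=> cf p; apply: cvgN; exact: cf. Qed.

Lemma continuous_sum (I : Type) (s : seq I) (F : I -> T -> R) :
  (forall i, continuous (F i)) -> continuous (fun p => \sum_(i <- s) F i p).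
Proof.
by move=> cF; apply: continuous_big => // p; exact: add_continuous.
Qed.

Lemma continuous_const (k : R) : continuous (fun _ : T => k).
Proof. by move=> p; exact: cvg_cst. Qed.

Lemma continuous_inner (d : nat) (v w : T -> 'rV[R]_d) :
  (forall j, continuous (fun p => v p ord0 j)) ->
  (forall j, continuous (fun p => w p ord0 j)) ->
  continuous (fun p => inner (v p) (w p)).
Proof. by move=> cv cw; apply: continuous_sum => j; exact: continuous_mul. Qed.

Lemma continuous_bary (d n : nat) (x : 'I_n -> 'rV[R]_d) (g : T -> 'I_n -> R) :
  (forall i, continuous (fun p => g p i)) ->
  forall j, continuous (fun p => bary (g p) x ord0 j).
Proof.
move=> cg j; rewrite /bary; under eq_fun do rewrite summxE.
apply: continuous_sum => i; under eq_fun do rewrite mxE.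
by apply: continuous_mul => //; exact: continuous_const.
Qed.

Lemma continuous_resid (d n : nat) (eps eta : R) (e u : 'rV[R]_d)
    (x : 'I_n -> 'rV[R]_d) (z : T -> 'rV[R]_d) (a : T -> 'I_n -> R) :
  (forall j, continuous (fun p => z p ord0 j)) ->
  (forall i, continuous (fun p => a p i)) ->
  forall j, continuous (fun p => resid eps eta e u (z p) x (a p) ord0 j).
Proof.
move=> cz ca j; under eq_fun do rewrite bary_resid !mxE.
apply: continuous_add; apply: continuous_add.
- exact: continuous_bary.
- apply: continuous_opp; apply: continuous_mul; first exact: continuous_sum.
  by apply: continuous_add; [exact: cz | exact: continuous_const].
- apply: continuous_mul; first exact: continuous_const.
  apply: continuous_add; first exact: continuous_const.
  by apply: continuous_opp; exact: cz.
- exact: continuous_const.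
Qed.

End Continuity.

Section Compactness.
Context {R : realType} {n : nat}.

Lemma continuous_sum_coord :
  continuous (fun v : 'rV[R]_n => \sum_i v ord0 i).
Proof. by apply: continuous_sum => i; exact: coord_continuous. Qed.

Lemma subprob_compact : compact [set v : 'rV[R]_n | subprob (v ord0)].
Proof.
have -> : [set v : 'rV[R]_n | subprob (v ord0)] =
    [set v : 'rV[R]_n | forall i, `[0, 1]%classic (v ord0 i)] `&`
    (fun v : 'rV[R]_n => \sum_i v ord0 i) @^-1` [set s : R | s <= 1].
  apply/seteqP; split=> v /= [v0 v1]; split=> // i; last first.
    by have := v0 i; rewrite in_itv /= => /andP[].
  rewrite in_itv /= v0 /=; apply: le_trans v1.
  by rewrite (bigD1 i) //= lerDl sumr_ge0.
apply: compact_closedI.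
  by apply: (@rV_compact R n (fun _ => `[0, 1]%classic)) => i; exact: segment_compact.
by move/continuous_closedP: continuous_sum_coord; apply; exact: closed_le.
Qed.

Lemma prob_compact : compact [set v : 'rV[R]_n | prob (v ord0)].
Proof.
have -> : [set v : 'rV[R]_n | prob (v ord0)] =
    [set v : 'rV[R]_n | subprob (v ord0)] `&`
    (fun v : 'rV[R]_n => \sum_i v ord0 i) @^-1` [set s : R | s = 1].
  apply/seteqP; split=> v /=.
    by move=> pv; split; [exact: prob_subprob | case: pv].
  by move=> [[v0 _] v1].
apply: compact_closedI; first exact: subprob_compact.
by move/continuous_closedP: continuous_sum_coord; apply; exact: closed_eq.
Qed.

End Compactness.

(** * The energy, its minimizers and their optimality conditions *)

Definition energy (R : realType) (d n : nat) (eps eta : R) (e u : 'rV[R]_d)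
    (c x : 'I_n -> 'rV[R]_d) (g a b : 'I_n -> R) : R :=
  let v := resid eps eta e u (bary g c) x a in
  let w := resid eps eta e (- u) (bary g c) x b in
  inner v v + inner w w.

(** For each [t] a continuous function on a compact set attains its minimum; the least of these
    finitely many minima is taken. [t0] and [i0] provide non-emptiness. *)
Lemma energy_min (R : realType) (d n : nat) (eps eta : R) (e u : 'rV[R]_d)
    (T : finType) (c : 'I_n -> 'rV[R]_d) (x : T -> 'I_n -> 'rV[R]_d)
    (t0 : T) (i0 : 'I_n) :
  exists t g a b, [/\ prob g, subprob a, subprob b &
    forall t' g' a' b', prob g' -> subprob a' -> subprob b' ->
      energy eps eta e u c (x t) g a b <= energy eps eta e u c (x t') g' a' b'].
Proof.
pose P := [set v : 'rV[R]_n | prob (v ord0)].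
pose S := [set v : 'rV[R]_n | subprob (v ord0)].
have rowE (f : 'I_n -> R) : (\row_i f i) ord0 = f by apply/funext => i; rewrite mxE.
pose F t (p : 'rV[R]_n * 'rV[R]_n * 'rV[R]_n) :=
  energy eps eta e u c (x t) (p.1.1 ord0) (p.1.2 ord0) (p.2 ord0).
have minF t : exists2 p, p \in (P `*` S) `*` S &
    forall q, q \in (P `*` S) `*` S -> F t p <= F t q.
  apply: compact_EVT_min.
  - exists (\row_i unit_wt R i0 i, \row_i unit_wt R i0 i, \row_i unit_wt R i0 i).
    have pu := prob_unit_wt (R := R) i0; have su := prob_subprob pu.
    by rewrite /P /S /=; do !split; rewrite rowE //; case: pu; case: su.
  - apply: compact_setX; last exact: subprob_compact.
    by apply: compact_setX; [exact: prob_compact | exact: subprob_compact].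
  apply: continuous_subspaceT.
  have cfst (U V : topologicalType) : continuous (@fst U V).
    by move=> p; exact: cvg_fst.
  have csnd (U V : topologicalType) : continuous (@snd U V).
    by move=> p; exact: cvg_snd.
  have cc (i : 'I_n) := @coord_continuous R 1 n ord0 i.
  have c11 i : continuous (fun p : 'rV[R]_n * 'rV[R]_n * 'rV[R]_n => p.1.1 ord0 i).
    move=> p; exact: continuous_comp (continuous_comp (cfst _ _ p) (cfst _ _ _)) (cc i _).
  have c12 i : continuous (fun p : 'rV[R]_n * 'rV[R]_n * 'rV[R]_n => p.1.2 ord0 i).
    move=> p; exact: continuous_comp (continuous_comp (cfst _ _ p) (csnd _ _ _)) (cc i _).
  have c2 i : continuous (fun p : 'rV[R]_n * 'rV[R]_n * 'rV[R]_n => p.2 ord0 i).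
    move=> p; exact: continuous_comp (csnd _ _ p) (cc i _).
  apply: continuous_add; apply: continuous_inner;
    by apply: continuous_resid => //; apply: continuous_bary.
have /choice[p pP] t : exists p, p \in (P `*` S) `*` S /\
    forall q, q \in (P `*` S) `*` S -> F t p <= F t q.
  by have [p pp pm] := minF t; exists p.
have [t _ tmin] := @arg_minP _ _ _ t0 predT (fun t => F t (p t)) isT.
have [/set_mem[[/= pg pa] pb] _] := pP t.
exists t, ((p t).1.1 ord0), ((p t).1.2 ord0), ((p t).2 ord0); split=> //.
move=> t' g' a' b' pg' sa' sb'.
have [_ /(_ (\row_i g' i, \row_i a' i, \row_i b' i))] := pP t'.
rewrite {2}/F /= !rowE => H; apply: (le_trans (tmin t' isT)); apply: H.
by apply/mem_set; rewrite /P /S /=; split; [split|]; rewrite /= rowE.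
Qed.

Lemma energy_min_center (R : realType) (d n : nat) (eps eta : R)
    (e u : 'rV[R]_d) (c x : 'I_n -> 'rV[R]_d) (g a b : 'I_n -> R) (i : 'I_n) :
  let z := bary g c in
  prob g ->
  (forall g', prob g' ->
    energy eps eta e u c x g a b <= energy eps eta e u c x g' a b) ->
  (\sum_k a k + eta) * inner (resid eps eta e u z x a) (c i - z) +
  (\sum_k b k + eta) * inner (resid eps eta e (- u) z x b) (c i - z) <= 0.
Proof.
move=> z pg H; set v := resid _ _ _ _ _ _ _; set w := resid _ _ _ _ _ _ _.
set A := _ + eta; set B := _ + eta; set h := c i - z.
suff : 0 <= - 2 * (A * inner v h + B * inner w h) by lra.
(* Moving [z] to [z + t *: h] changes the residuals by [- (t * A) *: h] and [- (t * B) *: h]. *)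
apply: (@first_order_ge0 _ _ ((A ^+ 2 + B ^+ 2) * inner h h)) => t t0 t1.
have /H : prob (mix t g (unit_wt R i)).
  by apply: prob_mix => //; [rewrite (ltW t0) | exact: prob_unit_wt].
have -> : energy eps eta e u c x g a b = inner v v + inner w w by [].
rewrite /energy bary_mix bary_unit_wt.
have -> : (1 - t) *: bary g c + t *: c i = z + t *: h.
  by rewrite /h -/z; apply/rowP => j; rewrite !mxE; ring.
rewrite !resid_shift -/v -/w -/A -/B; move: v w h A B => v w h A B.
rewrite !innerE (innerC h v) (innerC h w); lra.
Qed.

(** The obtuse angle for [x'] is tested against the unit weight at [i], whose residual is
    [y - z - u + eta *: (e - z)]; the bound on [inner v y] cancels [u]. *)
Lemma resid_free_color (R : realType) (d n : nat) (eps eta : R)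
    (e u z ci y : 'rV[R]_d) (x : 'I_n -> 'rV[R]_d) (a : 'I_n -> R) (i : 'I_n) :
  let v := resid eps eta e u z x a in
  let x' k := if k == i then y else x k in
  subprob a ->
  (forall a', subprob a' ->
    inner v v <= inner (resid eps eta e u z x' a') (resid eps eta e u z x' a')) ->
  resid eps eta e u z x' a = v ->
  inner v y <= inner v (ci + u) ->
  inner v v <= inner v (ci - z) + eta * inner v (e - z).
Proof.
move=> v x' sa H vE yv.
have := @resid_obtuse _ _ _ eps eta e u z x' a _ sa (prob_subprob (prob_unit_wt i)).
rewrite vE => /(_ H); rewrite resid_unit_wt /x' eqxx.
move: v yv {H vE} => v yv; rewrite innerDr innerDr innerDr !innerNr innerZr.
by move: yv; rewrite !innerDr innerNr; lra.
Qed.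

(** With total weight below 1 the residual is orthogonal to every generator in use, and these form a
    basis. *)
Lemma resid_full_support (R : realType) (d n : nat) (eps eta : R)
    (e u z : 'rV[R]_d) (x : 'I_n -> 'rV[R]_d) (a : 'I_n -> R) :
  let v := resid eps eta e u z x a in
  subprob a ->
  (forall a', subprob a' ->
    inner v v <= inner (resid eps eta e u z x a') (resid eps eta e u z x a')) ->
  indep_supp (fun i => x i - z - (1 - eps) *: u) a ->
  (d <= #|[pred i | a i != 0%R]|)%N ->
  v = 0 \/ \sum_i a i = 1.
Proof.
move=> v sa H ia da; have [|a1] := leP 1 (\sum_i a i).
  by move=> a1; right; apply/le_anti; rewrite a1 andbT; case: sa.
left; apply: (indep_supp_span ia da) => i ai.
exact: resid_orthogonal sa a1 ai H.
Qed.

(** * The minimal energy is zero *)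

Section Approximation.
Context {R : realType} {d n N : nat}.
Variables (u : 'rV[R]_d) (c : 'I_n -> 'rV[R]_d) (y : 'I_n -> 'I_N -> 'rV[R]_d).
Hypothesis uu : inner u u = 1.
Hypothesis dn : (d + d <= n)%N.
Hypothesis yP : forall i v, exists j, inner v (y i j) <= inner v (c i + u).
Hypothesis yN : forall i v, exists j, inner v (y i j) <= inner v (c i - u).
Variable i0 : 'I_n.
Let e := c i0.
Let D := \sum_i inner (e - c i) (e - c i).
Let x (t : {ffun 'I_n -> 'I_N}) i := y i (t i).

Lemma energy_approx (eps : R) : 0 < eps <= 1 ->
  exists t g a b, [/\ prob g, subprob a, subprob b &
    energy 1 0 e u c (x t) g a b <= 2 * (eps ^+ 2 * (4 + 2 * D))].
Proof.
move=> eps01; have /andP[e0 e1] := eps01.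
pose eta := eps ^+ 2; have eta0 : 0 < eta by rewrite exprn_gt0.
have [j0 _] := yP i0 0.
have [t [g [a0 [b0 [pg sa0 sb0 H0]]]]] :=
  energy_min eps eta e u c x [ffun=> j0] i0.
pose z := bary g c.
(* Caratheodory comes after the minimization: it preserves the residuals, so the reduced weights are
   still minimal. *)
have [a [an a_s aV ia]] :=
  conic_caratheodory (fun i => x t i - z - (1 - eps) *: u) (proj1 sa0).
have [b [bn b_s bV ib]] :=
  conic_caratheodory (fun i => x t i - z - (1 - eps) *: - u) (proj1 sb0).
have sa : subprob a by split=> //; apply: le_trans a_s (proj2 sa0).
have sb : subprob b by split=> //; apply: le_trans b_s (proj2 sb0).
have H t' g' a' b' : prob g' -> subprob a' -> subprob b' ->
    energy eps eta e u c (x t) g a b <= energy eps eta e u c (x t') g' a' b'.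
  move=> pg' sa' sb'; apply: le_trans (H0 _ _ _ _ pg' sa' sb').
  by rewrite /energy /resid -/z aV bV.
clear H0 a0 b0 sa0 sb0 a_s b_s aV bV.
pose v := resid eps eta e u z (x t) a.
pose w := resid eps eta e (- u) z (x t) b.
have EE : energy eps eta e u c (x t) g a b = inner v v + inner w w by [].
(* Competitor: [z = e] with zero weights, whose residuals are [- eps *: u] and [eps *: u]. *)
have bound : inner v v + inner w w <= 2 * eps ^+ 2.
  have pu := prob_unit_wt (R := R) i0.
  have s0 : subprob (fun _ : 'I_n => 0 : R) by split=> //; rewrite big1.
  have := H t _ _ _ pu s0 s0; rewrite EE => /le_trans; apply.
  rewrite /energy bary_unit_wt !bary_resid.
  have -> : bary (fun _ => 0) (x t) = 0 by rewrite /bary big1 // => i _; rewrite scale0r.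
  rewrite big1 // !scale0r !subr0 !add0r [e - c i0]subrr scaler0 !add0r scalerN opprK.
  by rewrite !innerE uu expr2; lra.
have [v0 w0] := (inner_ge0 v, inner_ge0 w).
have Ha a' : subprob a' -> inner v v <=
    inner (resid eps eta e u z (x t) a') (resid eps eta e u z (x t) a').
  by move=> sa'; have := H t g a' b pg sa' sb; rewrite EE /energy -/z -/w; lra.
have Hb b' : subprob b' -> inner w w <=
    inner (resid eps eta e (- u) z (x t) b') (resid eps eta e (- u) z (x t) b').
  by move=> sb'; have := H t g a b' pg sa sb'; rewrite EE /energy -/z -/v; lra.
have [va wb] : (v = 0 \/ \sum_i a i = 1) /\ (w = 0 \/ \sum_i b i = 1).
  have [[i [ai bi]]|nofree] := pselect (exists i, a i = 0 /\ b i = 0); last first.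
    (* The two supports cover all [n >= 2 d] colours and have at most [d] elements each, so each has
       at least [d]. *)
    have cab : (n <= #|[pred i | a i != 0%R]| + #|[pred i | b i != 0%R]|)%N.
      rewrite -cardUI -[X in (X <= _)%N]card_ord; apply: leq_trans (leq_addr _ _).
      apply/subset_leq_card/fintype.subsetP => i _; rewrite !unfold_in /=.
      apply/negP => /negP; rewrite negb_or !negbK => /andP[/eqP ai /eqP bi].
      by apply: nofree; exists i.
    have ca := indep_supp_card ia; have cb := indep_supp_card ib.
    split.
      apply: (resid_full_support sa Ha ia).
      by rewrite -(leq_add2r d) (leq_trans dn) // (leq_trans cab) // leq_add2l.
    apply: (resid_full_support sb Hb ib).
    by rewrite -(leq_add2l d) (leq_trans dn) // (leq_trans cab) // leq_add2r.
  pose sw j : {ffun 'I_n -> 'I_N} := [ffun k => if k == i then j else t k].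
  have xE j : x (sw j) = fun k => if k == i then y i j else x t k.
    by apply/funext => k; rewrite /x ffunE; case: eqP => // ->.
  have fixE u' f j : f i = 0 ->
      resid eps eta e u' z (x (sw j)) f = resid eps eta e u' z (x t) f.
    move=> fi; rewrite /resid xE; congr (_ + _); apply: eq_bigr => k _.
    by case: eqP => // ->; rewrite fi !scale0r.
  have V : inner v v <= inner v (c i - z) + eta * inner v (e - z).
    have [j yj] := yP i v; apply: (resid_free_color (i := i) sa _ _ yj).
      rewrite -/v -xE => a' sa'; have := H (sw j) g a' b pg sa' sb.
      by rewrite EE /energy -/z (fixE _ _ _ bi) -/w; lra.
    by rewrite -xE fixE.
  have W : inner w w <= inner w (c i - z) + eta * inner w (e - z).
    have [j yj] := yN i w; apply: (resid_free_color (i := i) sb _ _ yj).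
      rewrite -/w -xE => b' sb'; have := H (sw j) g a b' pg sa sb'.
      by rewrite EE /energy -/z (fixE _ _ _ ai) -/v; lra.
    by rewrite -xE fixE.
  have K k := energy_min_center k pg (fun g' pg' => H t g' a b pg' sa sb).
  (* [Ki] bounds the main terms of [V] and [W], weighted by [A] and [B]; [Ke], where [e = c i0],
     bounds their [eta] terms. Together [A |v|^2 + B |w|^2 <= 0], with [A, B > 0] thanks to
     [eta]. *)
  have := K i; have := K i0; rewrite -/z -/v -/w -/e => Ke Ki.
  have A0 : 0 < \sum_k a k + eta by rewrite ltr_wpDl // sumr_ge0.
  have B0 : 0 < \sum_k b k + eta by rewrite ltr_wpDl // sumr_ge0.
  move: (\sum_k a k + eta) (\sum_k b k + eta) A0 B0 Ki Ke => A B A0 B0 Ki Ke.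
  have AV := ler_wpM2l (ltW A0) V; have BW := ler_wpM2l (ltW B0) W.
  have eK : eta * (A * inner v (e - z) + B * inner w (e - z)) <= 0.
    by rewrite pmulr_rle0.
  have Av0 : 0 <= A * inner v v by rewrite mulr_ge0 // ltW.
  have Bw0 : 0 <= B * inner w w by rewrite mulr_ge0 // ltW.
  split; left; apply: inner_eq0; apply/le_anti; rewrite ?v0 ?w0 andbT.
    by rewrite -(pmulr_rle0 _ A0); nra.
  by rewrite -(pmulr_rle0 _ B0); nra.
have eD : inner (e - z) (e - z) <= D by apply: bary_dist_le.
have [|a' sa' Ra] := resid_estimate eps01 sa (erefl eta) eD _ va; first by rewrite -/v; lra.
have [|b' sb' Rb] := resid_estimate eps01 sb (erefl eta) eD _ wb; first by rewrite -/w; lra.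
by exists t, g, a', b'; split=> //; rewrite /energy -/z; lra.
Qed.

(** The unperturbed minimum [m] is attained and lies below every perturbed bound, so the limit is
    taken in values and not in minimizers. *)
Lemma energy_exact : exists t g a b, [/\ prob g, subprob a, subprob b &
  energy 1 0 e u c (x t) g a b = 0].
Proof.
have [j0 _] := yP i0 0.
have [t [g [a [b [pg sa sb H]]]]] := energy_min 1 0 e u c x [ffun=> j0] i0.
exists t, g, a, b; split=> //; set m := energy _ _ _ _ _ _ _ _ _ in H *.
apply/le_anti; have m0 : 0 <= m by rewrite addr_ge0 ?inner_ge0.
rewrite m0 andbT leNgt; apply/negP => mgt.
have D0 : 0 <= D by apply: sumr_ge0 => i _; exact: inner_ge0.
pose K := 2 * (4 + 2 * D); have K0 : 0 < K by rewrite /K; lra.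
(* Then [eps ^+ 2 * K <= eps * K = m - eps * m < m]. *)
pose eps := m / (m + K).
have mK : 0 < m + K by rewrite addr_gt0.
have e0 : 0 < eps by rewrite divr_gt0.
have e1 : eps <= 1 by rewrite ler_pdivrMr // mul1r; lra.
have [|t' [g' [a' [b' [pg' sa' sb']]]]] := @energy_approx eps; first by rewrite e0.
apply/negP; rewrite -ltNge; apply: lt_le_trans (H t' g' a' b' pg' sa' sb').
have -> : 2 * (eps ^+ 2 * (4 + 2 * D)) = eps * (eps * K) by rewrite /K; ring.
have eK : eps * (m + K) = m by rewrite /eps mulfVK // gt_eqF.
have : eps * (eps * K) <= 1 * (eps * K) by rewrite ler_pM2r // mulr_gt0.
have : 0 < eps * m by rewrite mulr_gt0.
lra.
Qed.

End Approximation.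

(** * From zero energy to the segment, and the theorem *)

Lemma resid_zero_hull (R : realType) (d n : nat) (e u z : 'rV[R]_d)
    (x : 'I_n -> 'rV[R]_d) (a : 'I_n -> R) : subprob a -> u != 0 ->
  resid 1 0 e u z x a = 0 ->
  exists2 s, 1 <= s & convex_hull (range x) (z + s *: u).
Proof.
move=> [a0 a1] u0; rewrite bary_resid subrr !scale0r addr0 sub0r scale1r.
move=> /eqP; rewrite -addrA -opprD subr_eq0 => /eqP xE.
set A := \sum_i a i in a1 xE.
(* [xE] reads [bary a x = A *: (z + 0) + u] up to simplification; with [A = 0] it would force
   [u = 0]. *)
have A0 : 0 < A.
  rewrite lt_def sumr_ge0 // andbT; apply: contra u0 => /eqP AE.
  have ai i : a i = 0.
    apply/eqP; rewrite eq_le a0 andbT -AE /A (bigD1 i) //= lerDl.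
    exact: sumr_ge0.
  move: xE; rewrite AE scale0r add0r => <-.
  by rewrite /bary big1 // => i _; rewrite ai scale0r.
exists A^-1; first by rewrite invf_ge1.
have -> : z + A^-1 *: u = bary (fun i => A^-1 * a i) x.
  transitivity (A^-1 *: bary a x).
    by rewrite xE scalerDr scalerA mulVf ?scale1r // gt_eqF.
  by rewrite /bary scaler_sumr; apply: eq_bigr => i _; rewrite scalerA.
apply: bary_hull; split=> [i|]; first by rewrite mulr_ge0 // invr_ge0 ltW.
by rewrite -mulr_sumr mulVf // gt_eqF.
Qed.

Lemma translate_segment_hull (R : realType) (d : nat) (u z : 'rV[R]_d)
    (X : set 'rV[R]_d) (s s' : R) : 1 <= s -> 1 <= s' ->
  convex_hull X (z + s *: u) -> convex_hull X (z - s' *: u) ->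
  translate z (sym_segment u) `<=` convex_hull X.
Proof.
move=> s1 s'1 Xp Xq _ [_ [l /= l1 <-] <-]; move: l1; rewrite ler_norml => /andP[l0 l1].
have ss : 0 < s + s' by lra.
(* The solution of [l = k * s - (1 - k) * s']. *)
pose k := (l + s') / (s + s').
have kE : k * (s + s') = l + s' by rewrite /k mulfVK // gt_eqF.
have -> : z + l *: u = k *: (z + s *: u) + (1 - k) *: (z - s' *: u).
  have -> : l = k * (s + s') - s' by rewrite kE addrK.
  by apply/rowP => j; rewrite !mxE; ring.
apply: convex_hull_seg => //; apply/andP; split.
  by apply: divr_ge0; lra.
by rewrite ler_pdivrMr // mul1r; lra.
Qed.

(** Replaces the arbitrary sets by finite lists of one common length, which makes the rainbow
    choices a finite type. *)
Lemma convex_hull_finite_family (R : realType) (d n : nat)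
    (X : 'I_n -> set 'rV[R]_d) (p q : 'I_n -> 'rV[R]_d) :
  (forall i, convex_hull (X i) (p i)) -> (forall i, convex_hull (X i) (q i)) ->
  exists (N : nat) (y : 'I_n -> 'I_N -> 'rV[R]_d), [/\ forall i j, X i (y i j),
    forall i v, exists j, inner v (y i j) <= inner v (p i) &
    forall i v, exists j, inner v (y i j) <= inner v (q i)].
Proof.
move=> /(_ _)/convex_hull_finite-/choice[s sP] /(_ _)/convex_hull_finite-/choice[t tP].
have /choice[y0 y0P] i : exists y, X i y.
  by have [sX /(_ 0)[y /sX Xy _]] := sP i; exists y.
pose S i := s i ++ t i.
pose N := (\max_i size (S i))%N.
(* Shorter lists are padded with [y0 i], itself a point of [X i]. *)
pose y i (j : 'I_N) := nth (y0 i) (S i) j.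
have yS i z : z \in S i -> exists j, y i j = z.
  move=> zS; have zN : (index z (S i) < N)%N.
    rewrite (leq_trans _ (leq_bigmax i)) //; by rewrite index_mem.
  by exists (Ordinal zN); rewrite /y nth_index.
exists N, y; split=> [i j|i v|i v].
- rewrite /y; have [jS|Sj] := ltnP j (size (S i)); last by rewrite nth_default.
  have := mem_nth (y0 i) jS; rewrite mem_cat => /orP[].
    exact: (proj1 (sP i)).
  exact: (proj1 (tP i)).
- have [z zs zv] := (proj2 (sP i)) v.
  have [|j yj] := yS i z; first by rewrite mem_cat zs.
  by exists j; rewrite yj.
- have [z zs zv] := (proj2 (tP i)) v.
  have [|j yj] := yS i z; first by rewrite mem_cat zs orbT.
  by exists j; rewrite yj.
Qed.

Unset Implicit Arguments.

Theorem theorem1p2 (R : realType) (d : nat) (hd : (2 <= d)%N)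
    (u : 'rV[R]_d) (hu : euclidean_norm u = 1)
    (X : 'I_(2 * d) -> set 'rV[R]_d) (c : 'I_(2 * d) -> 'rV[R]_d)
    (hX : forall i : 'I_(2 * d),
      translate (c i) (sym_segment u) `<=` convex_hull (X i)) :
  exists (x : 'I_(2 * d) -> 'rV[R]_d) (c0 : 'rV[R]_d),
    [/\ forall i : 'I_(2 * d), X i (x i),
        convex_hull (range c) c0 &
        translate c0 (sym_segment u) `<=` convex_hull (range x)].
Proof.
have uu : inner u u = 1.
  have : 0 <= \sum_(i < d) u ord0 i ^+ 2 by apply: sumr_ge0 => i _; exact: sqr_ge0.
  move=> /sqr_sqrtr; rewrite -/(euclidean_norm u) hu expr1n => ->.
  by apply: eq_bigr => i _; rewrite expr2.
have u0 : u != 0.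
  by apply/eqP => uE; move/eqP: uu; rewrite uE inner0r eq_sym oner_eq0.
have seg i (l : R) : `|l| <= 1 -> convex_hull (X i) (c i + l *: u).
  by move=> l1; apply: hX; exists (l *: u) => //; exists l.
(* The argument uses the two endpoints of each given segment. *)
have hp i : convex_hull (X i) (c i + u).
  by rewrite -[u]scale1r; apply: seg; rewrite normr1.
have hq i : convex_hull (X i) (c i - u).
  by rewrite -scaleN1r; apply: seg; rewrite normrN1.
have [N [y [yX yP yN]]] := convex_hull_finite_family hp hq.
have dd : (d + d <= 2 * d)%N by rewrite addnn mul2n.
have d0 : (0 < 2 * d)%N by rewrite muln_gt0 /= (leq_trans _ hd).
have [t [g [a [b [pg sa sb E]]]]] := energy_exact uu dd yP yN (Ordinal d0).
move/eqP: E; rewrite /energy paddr_eq0 ?inner_ge0 // => /andP[/eqP E1 /eqP E2].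
have [s s1 Hs] := resid_zero_hull sa u0 (inner_eq0 E1).
have u0' : - u != 0 by rewrite oppr_eq0.
have [s' s'1 Hs'] := resid_zero_hull sb u0' (inner_eq0 E2).
exists (fun i => y i (t i)), (bary g c); split=> //; first exact: bary_hull.
by apply: (translate_segment_hull s1 s'1 Hs); rewrite -scalerN.
Qed.
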